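(* Let $G_1$ and $G_2$ be simple connected graphs, neither of which contains a well-connected vertex. Then the symmetric difference $G_1\oplus G_2$ satisfies \[ C^\xi(G_1\oplus G_2) = |E(G_1)|\,|V(G_2)|^2 + |E(G_2)|\,|V(G_1)|^2 - 4|E(G_1)|\,|E(G_2)| . \]
   Context: A vertex of a graph is well-connected if it is adjacent to all other vertices of the graph. The symmetric difference $G_1\oplus G_2$ has vertex set $V(G_1)\times V(G_2)$, with $(u_1,u_2)$ adjacent to $(v_1,v_2)$ whenever $u_1$ is adjacent to $v_1$ in $G_1$ or $u_2$ is adjacent to $v_2$ in $G_2$, but not both. For a connected graph $H$, $d_H(v)$ is the degree of $v$, the eccentricity $\varepsilon_H(v)$ is the largest distance from $v$ to any other vertex, and the connective eccentric index is $C^\xi(H)=\sum_{v\in V(H)} \frac{d_H(v)}{\varepsilon_H(v)}$. *)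

(* Defs.v *)
From mathcomp Require Import all_boot all_order all_algebra.

Set Implicit Arguments.
Unset Strict Implicit.
Unset Printing Implicit Defensive.

Import GRing.Theory.
Local Open Scope ring_scope.

(* A finite simple graph is given by its vertex type [T : finType] and a
   symmetric irreflexive adjacency relation [e : rel T]. *)
Definition simple_graph (T : finType) (e : rel T) : Prop :=
  symmetric e /\ irreflexive e.

Definition connected_graph (T : finType) (e : rel T) : Prop :=
  (0 < #|T|)%N /\ forall x y : T, connect e x y.

Definition well_connected (T : finType) (e : rel T) (x : T) : Prop :=
  forall y : T, y != x -> e x y.

Definition edges (T : finType) (e : rel T) : {set {set T}} :=
  [set [set p.1; p.2] | p : T * T & e p.1 p.2].

Definition symdiff_graph (T1 T2 : finType) (e1 : rel T1) (e2 : rel T2) :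
    rel (T1 * T2)%type :=
  fun u v => e1 u.1 v.1 (+) e2 u.2 v.2.

Definition degree (T : finType) (e : rel T) (x : T) : nat :=
  #|[set y | e x y]|.

(* There is a walk with exactly [n] edges from [x] to [y]. *)
Definition walk_of_length (T : finType) (e : rel T) (x y : T) (n : nat) : bool :=
  [exists p : n.-tuple T, path e x p && (last x p == y)].

(* The length of a shortest walk.  Connected vertices are always joined by a
   walk with fewer than [#|T|] edges, so bounding [n] loses nothing; the value
   [#|T|] is returned only when [y] is not reachable from [x]. *)
Definition dist (T : finType) (e : rel T) (x y : T) : nat :=
  \big[minn/#|T|]_(n < #|T| | walk_of_length e x y n) n.

Definition eccentricity (T : finType) (e : rel T) (x : T) : nat :=
  \max_(y | y != x) dist e x y.

Definition connective_eccentric_index (T : finType) (e : rel T) : rat :=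
  \sum_(x : T) (degree e x)%:R / (eccentricity e x)%:R.

(* Main.v *)
Require Import Defs.
From mathcomp Require Import all_boot all_order all_algebra.
From mathcomp Require Import ring.

(** Every vertex of the symmetric difference has eccentricity exactly 2, so the
    index is half the sum of the degrees, which the handshake lemma evaluates.
    If [u] and [v] are not adjacent in [symdiff_graph e1 e2], they are adjacent
    in both coordinates, where [(u.1, v.2)] is a common neighbour, or in none,
    where one is found among [(w1, u.2)], [(u.1, w2)] and [(w1, w2)] with [w1] a
    neighbour of [u.1] and [w2] a neighbour of [v.2]. *)

Set Implicit Arguments.
Unset Strict Implicit.

Import GRing.Theory Num.Theory.
Local Open Scope ring_scope.

Lemma dist_le (T : finType) (e : rel T) (x y : T) (n : nat) :
  (n < #|T|)%N -> walk_of_length e x y n -> (dist e x y <= n)%N.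
Proof.
move=> ltn wn; rewrite /dist.
elim: index_enum (mem_index_enum (Ordinal ltn)) => // i r IH.
rewrite inE big_cons => /orP[/eqP <- /= | /IH le_n]; first by rewrite wn geq_minl.
by case: ifP => // _; rewrite geq_min le_n orbT.
Qed.

(** The condition [k <= #|T|] covers the default value of the minimum in [dist]. *)
Lemma dist_ge (T : finType) (e : rel T) (x y : T) (k : nat) :
  (k <= #|T|)%N -> (forall n, walk_of_length e x y n -> (k <= n)%N) ->
  (k <= dist e x y)%N.
Proof.
move=> lek wk; rewrite /dist.
elim/big_ind: _ => // [a b ka kb | i /wk //]; by rewrite leq_min ka kb.
Qed.

Lemma walk0E (T : finType) (e : rel T) (x y : T) :
  walk_of_length e x y 0 = (x == y).
Proof.
apply/existsP/idP => [[p] | xy]; first by rewrite tuple0.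
by exists [tuple].
Qed.

Lemma walk1E (T : finType) (e : rel T) (x y : T) :
  walk_of_length e x y 1 = e x y.
Proof.
apply/existsP/idP => [[[[|z []] //= _]] | exy].
  by rewrite andbT => /andP[exz /eqP <-].
by exists [tuple y]; rewrite /= exy eqxx.
Qed.

Lemma walk2 (T : finType) (e : rel T) (x z y : T) :
  e x z -> e z y -> walk_of_length e x y 2.
Proof.
by move=> exz ezy; apply/existsP; exists [tuple z; y]; rewrite /= exz ezy eqxx.
Qed.

(** Midpoints bound every distance by 2, and the non-neighbour attains 2. Since [2 < #|T|], walks of
    length 2 lie in the range over which [dist] minimises. *)
Lemma eccentricity2 (T : finType) (e : rel T) (x : T) :
  (2 < #|T|)%N -> (exists2 y, y != x & ~~ e x y) ->
  (forall y, y != x -> ~~ e x y -> exists2 z, e x z & e z y) ->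
  eccentricity e x = 2%N.
Proof.
move=> T2 [y0 y0x nexy0] mid.
apply/eqP; rewrite eqn_leq; apply/andP; split.
  apply/bigmax_leqP => y yx; have [exy | nexy] := boolP (e x y).
    by apply: (@leq_trans 1) => //; rewrite dist_le ?walk1E // ltnW.
  by have [z exz ezy] := mid y yx nexy; apply: dist_le (walk2 exz ezy).
apply: (bigmax_sup y0) => //; apply: dist_ge; first exact: ltnW.
case=> [|[|n]] //; first by rewrite walk0E eq_sym (negPf y0x).
by rewrite walk1E (negPf nexy0).
Qed.

Lemma exists_nonneighbour (T : finType) (e : rel T) (x : T) :
  ~ (exists x, well_connected e x) -> exists2 y, y != x & ~~ e x y.
Proof.
move=> nwc; have [/forall_inP wc | ] := boolP [forall (y | y != x), e x y].
  by case: nwc; exists x.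
by rewrite negb_forall_in => /exists_inP[y yx nexy]; exists y.
Qed.

Lemma exists_neighbour (T : finType) (e : rel T) (x y : T) :
  connected_graph e -> y != x -> exists z, e x z.
Proof.
move=> [_ /(_ x y)/connectP[[|z p] /= pth ->]]; first by rewrite eqxx.
by move: pth => /andP[exz _] _; exists z.
Qed.

Lemma card_gt1_no_well_connected (T : finType) (e : rel T) :
  (0 < #|T|)%N -> ~ (exists x, well_connected e x) -> (1 < #|T|)%N.
Proof.
move=> /card_gt0P[x _] nwc; have [y yx _] := exists_nonneighbour x nwc.
by apply/card_gt1P; exists y, x.
Qed.

Lemma eccentricity_symdiff (T1 T2 : finType) (e1 : rel T1) (e2 : rel T2)
    (u : T1 * T2) :
  simple_graph e1 -> simple_graph e2 ->
  connected_graph e1 -> connected_graph e2 ->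
  ~ (exists x, well_connected e1 x) -> ~ (exists x, well_connected e2 x) ->
  eccentricity (symdiff_graph e1 e2) u = 2%N.
Proof.
move=> [sym1 irr1] [sym2 irr2] conn1 conn2 nwc1 nwc2.
apply: eccentricity2.
- have T1gt1 := card_gt1_no_well_connected conn1.1 nwc1.
  have T2gt1 := card_gt1_no_well_connected conn2.1 nwc2.
  by rewrite card_prod (leq_trans _ (leq_mul T1gt1 T2gt1)).
(* With equal second coordinates, adjacency reduces to that of [e1]. *)
- have [y yu neuy] := exists_nonneighbour u.1 nwc1.
  exists (y, u.2); last by rewrite /symdiff_graph /= irr2 addbF.
  by apply: contra_neq yu => <-.
move=> v _; rewrite /symdiff_graph.
(* The two mixed cases contradict the non-adjacency of [u] and [v]. *)
have [e1uv | ne1uv] := boolP (e1 u.1 v.1);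
  have [e2uv | ne2uv] := boolP (e2 u.2 v.2) => //= _.
  by exists (u.1, v.2); rewrite /= ?irr1 ?irr2 ?e1uv ?e2uv.
(* [y1] and [y2] serve only as second vertices, so that connectedness yields the neighbours [w1] and
   [w2]. *)
have [y1 y1u _] := exists_nonneighbour u.1 nwc1.
have [y2 y2v _] := exists_nonneighbour v.2 nwc2.
have [w1 uw1] := exists_neighbour conn1 y1u.
have [w2 vw2] := exists_neighbour conn2 y2v.
have [w1v | nw1v] := boolP (e1 w1 v.1).
  by exists (w1, u.2); rewrite /= ?irr2 ?uw1 ?w1v ?(negPf ne2uv).
have [uw2 | nuw2] := boolP (e2 u.2 w2).
  by exists (u.1, w2); rewrite /= ?irr1 ?uw2 ?(negPf ne1uv) ?(sym2 w2) ?vw2.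
(* Now [(w1, w2)] is joined to [u] through the first coordinate only, and to [v] through the second
   only. *)
by exists (w1, w2); rewrite /= ?uw1 ?(negPf nuw2) ?(negPf nw1v) ?(sym2 w2) ?vw2.
Qed.

Lemma degreeE (T : finType) (e : rel T) (x : T) :
  degree e x = (\sum_y e x y)%N.
Proof. by rewrite /degree cardsE -sum1_card big_mkcond. Qed.

(** Both sides count the ordered adjacent pairs: by first entry on the left, by underlying unordered
    edge on the right. *)
Lemma handshake (T : finType) (e : rel T) :
  simple_graph e -> (\sum_x degree e x = 2 * #|edges e|)%N.
Proof.
move=> [sym irr].
have -> : (\sum_x degree e x = \sum_(p : T * T | e p.1 p.2) 1)%N.
  under eq_bigr do rewrite degreeE.
  by rewrite pair_big /= [RHS]big_mkcond.
rewrite (partition_big (fun p => [set p.1; p.2]) (mem (edges e))) /=; last first.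
  by move=> p ep; apply/imsetP; exists p; rewrite ?inE.
rewrite mulnC -sum_nat_const; apply: eq_bigr => _ /imsetP[[a b] + ->] /=.
rewrite inE /= => eab.
have neab : a != b by apply: contraTneq eab => ->; rewrite irr.
(* The fibre over the edge consists of its two orientations, distinct because there are no loops. *)
have -> : 2%N = #|[set (a, b); (b, a)]| by rewrite cards2 xpair_eqE (negPf neab).
rewrite sum1_card.
  apply: eq_card => -[c d].
  rewrite !inE unfold_in /= !xpair_eqE.
  apply/andP/orP => [[ecd /eqP cd] | [] /andP[/eqP-> /eqP->]].
  - have necd : c != d by apply: contraTneq ecd => ->; rewrite irr.
    have := set21 c d; have := set22 c d; rewrite cd !inE.
    move=> /orP[] /eqP dE /orP[] /eqP cE; subst; rewrite ?eqxx in necd *;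
    by auto.
  - by rewrite eab eqxx.
  - by rewrite sym eab setUC eqxx.
Qed.

(** Sum over all vertices of the product the identity [a (+) b = a + b - 2ab] for truth values read
    as 0 and 1. Working in a ring makes the subtraction exact. *)
Lemma degree_symdiff (R : comNzRingType) (T1 T2 : finType) (e1 : rel T1)
    (e2 : rel T2) (u : T1 * T2) :
  (degree (symdiff_graph e1 e2) u)%:R =
    (degree e1 u.1)%:R * #|T2|%:R + (degree e2 u.2)%:R * #|T1|%:R
    - 2 * (degree e1 u.1)%:R * (degree e2 u.2)%:R :> R.
Proof.
(* Cardinalities become sums of ones, so that each product expands into a double sum. *)
have cardE (T : finType) : #|T|%:R = \sum_(x : T) 1 :> R.
  by rewrite sumr_const.
rewrite !degreeE !natr_sum [_ * #|T1|%:R]mulrC !cardE -mulrA !big_distrlr /=.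
rewrite mulr_sumr -big_split -sumrB /=.
rewrite -(pair_bigA _ (fun x y => (symdiff_graph e1 e2 u (x, y))%:R)) /=.
apply: eq_bigr => x _; rewrite mulr_sumr -big_split -sumrB /=.
apply: eq_bigr => y _; rewrite /symdiff_graph /=.
case: (e1 _ _); case: (e2 _ _) => /=; ring.
Qed.

Theorem theorem5 (T1 T2 : finType) (e1 : rel T1) (e2 : rel T2)
    (simple1 : simple_graph e1) (simple2 : simple_graph e2)
    (conn1 : connected_graph e1) (conn2 : connected_graph e2)
    (nwc1 : ~ exists x : T1, well_connected e1 x)
    (nwc2 : ~ exists x : T2, well_connected e2 x) :
  connective_eccentric_index (symdiff_graph e1 e2) =
    #|edges e1|%:R * #|T2|%:R ^+ 2 + #|edges e2|%:R * #|T1|%:R ^+ 2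
    - 4 * #|edges e1|%:R * #|edges e2|%:R.
Proof.
rewrite /connective_eccentric_index.
under eq_bigr do rewrite eccentricity_symdiff // degree_symdiff.
rewrite -mulr_suml.
have sum_const (T : finType) (a : rat) : \sum_(x : T) a = a * #|T|%:R.
  by rewrite sumr_const mulr_natr.
have degsum (T : finType) (e : rel T) : simple_graph e ->
    \sum_x (degree e x)%:R = 2 * #|edges e|%:R :> rat.
  by move=> se; rewrite -natr_sum handshake // natrM.
(* The degree sum is twice the claimed value; the 8 is the 2 of the degree formula times one
   handshake factor 2 from each graph. *)
have -> : \sum_u ((degree e1 u.1)%:R * #|T2|%:R + (degree e2 u.2)%:R * #|T1|%:R
      - 2 * (degree e1 u.1)%:R * (degree e2 u.2)%:R) =
    2 * #|edges e1|%:R * #|T2|%:R ^+ 2 + 2 * #|edges e2|%:R * #|T1|%:R ^+ 2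
    - 8 * #|edges e1|%:R * #|edges e2|%:R :> rat.
  rewrite sumrB big_split /=.
  rewrite -(pair_bigA _ (fun x y => (degree e1 x)%:R * #|T2|%:R)).
  rewrite -(pair_bigA _ (fun x y => (degree e2 y)%:R * #|T1|%:R)).
  rewrite -(pair_bigA _ (fun x y => 2 * (degree e1 x)%:R * (degree e2 y)%:R)) /=.
  (* After the exchange the inner sum runs over the first coordinate, on which the second term does
     not depend. *)
  rewrite [X in _ + X - _]exchange_big /=.
  under eq_bigr do rewrite sum_const.
  under [X in _ + X - _]eq_bigr do rewrite sum_const.
  under [X in _ - X]eq_bigr do rewrite -mulr_sumr degsum //.
  rewrite -!mulr_suml -mulr_sumr !degsum //.
  move: (#|T1|%:R) (#|T2|%:R) (#|edges e1|%:R) (#|edges e2|%:R) => n1 n2 m1 m2.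
  ring.
move: (#|T1|%:R) (#|T2|%:R) (#|edges e1|%:R) (#|edges e2|%:R) => n1 n2 m1 m2.
by field.
Qed.
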